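(* Let a group $G$ act on a set $U$, and let $\mathcal{F}$ be a $G$-invariant family of finite subsets of $U$ whose cardinalities are bounded (i.e. $\sup_{F\in\mathcal{F}}|F|<\infty$). Let $X\subseteq U$ be a finite system of representatives for $\mathcal{F}$, i.e. $X\cap F\neq\varnothing$ for all $F\in\mathcal{F}$. Let $F\in\mathcal{F}$, and suppose the $G$-orbits in $U$ having nonempty intersection with $F$ are exactly $V_1,\dots,V_n$. Then $$\sum_{i=1}^{n}\frac{|F\cap V_i|\,|X\cap V_i|}{|V_i|}\geqslant 1,$$ where $\frac{1}{|V_i|}$ is interpreted as $0$ when $V_i$ is infinite.
   Context: A family $\mathcal{F}$ of subsets of $U$ is simply a set of subsets (unordered). $\mathcal{F}$ is $G$-invariant if $gF=\{gf\mid f\in F\}\in\mathcal{F}$ for all $g\in G$ and $F\in\mathcal{F}$. The orbits $V_i$ are orbits of the action of $G$ on $U$. *)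

(* Defs.v *)
From HB Require Import structures.
From mathcomp Require Import all_boot all_order all_algebra.
From mathcomp Require Import finmap.
From mathcomp Require Import mathcomp_extra boolp classical_sets functions cardinality.

Set Implicit Arguments.
Unset Strict Implicit.
Unset Printing Implicit Defensive.

Import Order.TTheory GRing.Theory Num.Theory.
Local Open Scope classical_set_scope.

(* MathComp's own actions require a finite acting group; here [G] may be
   infinite, hence this definition of a left action. *)
Definition is_left_action (G : groupType) (U : Type) (act : G -> U -> U) : Prop :=
  (forall u, act 1%g u = u) /\
  (forall g h u, act (g * h)%g u = act g (act h u)).

Definition act_orbit (G : groupType) (U : Type) (act : G -> U -> U) (u : U) :
  set U := [set act g u | g in [set: G]].

Definition orbits (G : groupType) (U : Type) (act : G -> U -> U) :
  set (set U) := [set act_orbit act u | u in [set: U]].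

Definition invariant_family (G : groupType) (U : Type) (act : G -> U -> U)
    (FF : set (set U)) : Prop :=
  forall g F, FF F -> FF (act g @` F).

(* [{classic U}] only equips [U] with the choice structure that [fset_set]
   needs. The value is the junk 0 when [A] is infinite. *)
Definition set_card (U : Type) (A : set U) : nat :=
  #|` fset_set (A : set {classic U})|%fset.

(* 1 / |A|, read as 0 when [A] is infinite. *)
Definition inv_card (U : Type) (A : set U) : rat :=
  if `[< finite_set A >] then ((set_card A)%:R^-1)%R else 0%R.

(* Main.v *)
(* Since every translate of F meets X, G is the union of the sets {g | g f = x},
   for f in F and x in X, which are empty or cosets of the stabiliser of f. The
   elements f with an infinite orbit can be discarded: let s list the elements
   of F with a finite orbit, so that the orbit O of the tuple s is finite. If some
   t in O did not meet X, the g with g s = t would be covered by the sets with f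
   in an infinite orbit, and finitely many translates of them would cover G,
   contradicting B.H. Neumann's lemma. So every t in O has an entry in X; as the
   entry indexed by f is uniformly distributed over the orbit of f when t ranges
   over O, a union bound gives the inequality. *)

Require Import Defs.
From HB Require Import structures.
From mathcomp Require Import all_boot all_order all_algebra.
From mathcomp Require Import finmap.
From mathcomp Require Import mathcomp_extra boolp classical_sets functions cardinality.

Import Order.TTheory GRing.Theory Num.Theory.
Local Open Scope classical_set_scope.

Lemma actK (G : groupType) (U : Type) (act : G -> U -> U) (g : G) :
  is_left_action act -> cancel (act g) (act g^-1%g).
Proof. by case=> act1 actM u; rewrite -actM mulVg act1. Qed.

Lemma actKV (G : groupType) (U : Type) (act : G -> U -> U) (g : G) :
  is_left_action act -> cancel (act g^-1%g) (act g).
Proof. by case=> act1 actM u; rewrite -actM mulgV act1. Qed.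

Lemma act_orbit_id (G : groupType) (U : Type) (act : G -> U -> U) (u : U) :
  is_left_action act -> act_orbit act u u.
Proof. by case=> act1 _; exists 1%g. Qed.

Lemma act_orbit_eq (G : groupType) (U : Type) (act : G -> U -> U) (u v : U) :
  is_left_action act -> act_orbit act u v -> act_orbit act v = act_orbit act u.
Proof.
move=> actP [h _ <-]; case: (actP) => _ actM; apply/seteqP; split => w [g _ <-].
  by exists (g * h)%g => //; rewrite actM.
by exists (g * h^-1)%g => //; rewrite actM actK.
Qed.

Lemma map_left_action (G : groupType) (U : Type) (act : G -> U -> U) :
  is_left_action act -> is_left_action (fun g => map (act g)).
Proof.
case=> act1 actM; split=> [s|g h s].
  by rewrite -[RHS]map_id; apply: eq_map.
by rewrite -map_comp; apply: eq_map.
Qed.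

(** The orbit of [u :: s] lies in the image under [cons] of the product of the orbits of [u] and
    [s]. *)
Lemma finite_act_orbit_map (G : groupType) (U : eqType) (act : G -> U -> U)
    (s : seq U) :
  (forall u, u \in s -> finite_set (act_orbit act u)) ->
  finite_set (act_orbit (fun g => map (act g)) s).
Proof.
elim: s => [|u s IHs] fin_s.
  by apply: (@sub_finite_set _ _ [set [::]]) => // _ [g _ <-].
have fin_u := fin_s u (mem_head u s).
have {}IHs := IHs (fun v vs => fin_s v (mem_behead (s := u :: s) vs)).
apply: sub_finite_set (finite_image2 cons fin_u IHs) => _ [g _ <-] /=.
by exists (act g u); [exists g | exists (map (act g) s); [exists g |]].
Qed.

(* B.H. Neumann's lemma in terms of actions: the g with g f = x form a coset of
   the stabiliser of f. If y in the orbit of f is the second component of no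
   pair, then the coset g f = y is covered by the pairs with another first
   component, hence so are all the cosets of the stabiliser of f after
   translating these pairs. *)
Lemma infinite_orbits_not_cover (G : groupType) (U : eqType)
    (act : G -> U -> U) (s : seq U) (L : seq (U * U)) :
  is_left_action act ->
  (forall u, u \in s -> infinite_set (act_orbit act u)) ->
  (forall p, p \in L -> p.1 \in s) ->
  exists g, forall p, p \in L -> act g p.1 <> p.2.
Proof.
move=> actP; case: (actP) => act1 actM.
elim: s L => [|f s IHs] L inf_s Ls; first by exists 1%g => p /Ls.
have inf_f := inf_s f (mem_head f s).
have {}IHs L' := IHs L' (fun v vs => inf_s v (mem_behead (s := f :: s) vs)).
have [y [[k _ kfy] yL]] :
    (act_orbit act f `\` [set` [seq p.2 | p <- L]]) !=set0.
  by apply: infinite_setN0; apply: infinite_setD.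
have /boolp.choice[h hP] x : exists g, act_orbit act y x -> act g y = x.
  have [[g _ gy]|no] := pselect (act_orbit act y x); first by exists g.
  by exists 1%g.
apply: contrapT => /forallNP uncovered.
have cover g : exists2 p, p \in L & act g p.1 = p.2.
  apply: contrapT => no; apply: (uncovered g) => p pL gp.
  by apply: no; exists p.
pose L2 := [seq p <- L | p.1 != f].
(* If [g] sends [f] to [p.2], then [(h p.2)^-1 * g] sends [f] to [y]. So it is covered by some [q]
   in [L2], and [g] sends [q.1] to [act (h p.2) q.2]. *)
pose T := [seq (q.1, act (h p.2) q.2) | p <- L, q <- L2].
have [|g gP] := IHs (L2 ++ T).
  move=> p; rewrite mem_cat => /orP[|/allpairsP[[a b] /= [_ + ->]]] /=;
    by rewrite mem_filter => /andP[/negPf pf /Ls]; rewrite inE pf.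
have [p pL gp] := cover g.
have [pf|npf] := eqVneq p.1 f; last first.
  by apply: (gP p) => //; rewrite mem_cat mem_filter npf pL.
have hy : act (h p.2) y = p.2.
  by apply: hP; exists (g * k^-1)%g => //; rewrite actM -kfy actK// -pf.
have [q qL gq] := cover ((h p.2)^-1 * g)%g.
have nqf : q.1 != f.
  apply/eqP => qf; apply: yL => /=; apply/mapP; exists q => //.
  by rewrite -gq qf actM -pf gp -{2}hy actK.
apply: (gP (q.1, act (h p.2) q.2)).
  by rewrite mem_cat; apply/orP; right; apply/allpairsP; exists (p, q);
    rewrite mem_filter nqf.
by rewrite /= -gq actM actKV.
Qed.

Lemma set_card_setI (U : Type) (A B : set U) : finite_set A ->
  set_card (A `&` B) =
  (\sum_(u <- fset_set (A : set {classic U})) (u \in (B : set {classic U})))%N.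
Proof.
move=> finA; rewrite /set_card card_fset_sum1 -big_mkcond [RHS]big_fset_condE.
apply: eq_fbigl => u; rewrite !inE in_fset_set; last first.
  by apply: sub_finite_set finA => v [].
by rewrite in_fset_set // in_setI.
Qed.

Lemma set_card_gt0 (U : Type) (A : set U) :
  finite_set A -> A !=set0 -> (0 < set_card A)%N.
Proof.
move=> finA [u Au]; rewrite /set_card cardfs_gt0; apply/fset0Pn.
by exists (u : {classic U}); rewrite in_fset_set// inE.
Qed.

(* All the fibres of p above the orbit of p a are translates of one another. *)
Lemma set_card_orbit_preimage (G : groupType) (A B : Type) (actA : G -> A -> A)
    (actB : G -> B -> B) (p : A -> B) (a : A) (Y : set B) :
  is_left_action actA -> is_left_action actB ->
  (forall g, p (actA g a) = actB g (p a)) ->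
  finite_set (act_orbit actA a) ->
  (set_card (act_orbit actA a `&` p @^-1` Y) * set_card (act_orbit actB (p a)) =
   set_card (act_orbit actA a) * set_card (act_orbit actB (p a) `&` Y))%N.
Proof.
move=> actAP actBP pE finA.
set O := act_orbit actA a; set B' := act_orbit actB (p a).
have BE : B' = p @` O.
  apply/seteqP; split=> [_ [g _ <-]|_ [_ [g _ <-] <-]].
    by exists (actA g a); [exists g | rewrite pE].
  by exists g; rewrite ?pE.
have finB : finite_set B' by rewrite BE; exact: finite_image.
pose fib b := set_card (O `&` p @^-1` [set b]).
have fibE b : B' b -> fib b = fib (p a).
  move=> [h _ <-]; rewrite /fib.
  suff -> : O `&` p @^-1` [set actB h (p a)] = actA h @` (O `&` p @^-1` [set p a]).
    rewrite /set_card.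
    rewrite (@fset_set_image {classic A} {classic A}); last first.
      by apply: sub_finite_set finA => v [].
    by rewrite card_imfset //=; apply: can_inj (actK _ _ _ h actAP).
  have pO g t : O t -> p (actA g t) = actB g (p t).
    by move=> [k _ <-]; rewrite -actAP.2 !pE actBP.2.
  have OE g t : O t -> O (actA g t).
    by move=> [k _ <-]; exists (g * k)%g; rewrite ?actAP.2.
  apply/seteqP; split=> [t [Ot /= pt]|_ [t [Ot /= pt] <-]].
    exists (actA h^-1%g t); last exact: actKV.
    by split; [exact: OE | rewrite /= pO// pt actK].
  by split; [exact: OE | rewrite /= pO// pt].
(* Sum over the fibres of [p] above [B'], all of size [fib (p a)]. Taking [Y] and [setT] for [Z]
   evaluates both sides of the claim. *)
have sumE (Z : set B) : set_card (O `&` p @^-1` Z) = (fib (p a) * set_card (B' `&` Z))%N.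
  rewrite !set_card_setI// (partition_big_imfset _ (p : {classic A} -> {classic B}))/=.
  rewrite -(@fset_set_image {classic A} {classic B})// -BE big_distrr/=.
  apply: eq_fbigr => b; rewrite in_fset_set// inE => Bb _.
  rewrite -(fibE b Bb) /fib set_card_setI// big_distrl big_mkcond /=.
  apply: eq_bigr => t _.
  have -> : (t \in (p @^-1` [set b] : set {classic A})) = ((p t : {classic B}) == b).
    by apply/idP/eqP; rewrite inE.
  by case: eqP => [<-|]; rewrite ?mul0n// mul1n; congr nat_of_bool; apply/idP/idP; rewrite !inE.
have cardO : set_card O = (fib (p a) * set_card B')%N.
  by have := sumE setT; rewrite preimage_setT !setIT.
by rewrite sumE cardO mulnAC.
Qed.

Lemma inv_card_ge0 (U : Type) (A : set U) : (0 <= inv_card A)%R.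
Proof. by rewrite /inv_card; case: ifP => // _; rewrite invr_ge0 ler0n. Qed.

Local Open Scope ring_scope.

(** The sum runs over points rather than orbits because the points of [F] with a finite orbit index
    the entries of a tuple, and the union bound has one term per entry. *)
Lemma sum_orbit_density_ge1 (G : groupType) (U : Type) (act : G -> U -> U)
    (F X : set U) :
  is_left_action act -> finite_set F -> finite_set X ->
  (forall g, (X `&` act g @` F) !=set0) ->
  1 <= \sum_(f <- fset_set (F : set {classic U}))
         (set_card (act_orbit act f `&` X))%:R * inv_card (act_orbit act f).
Proof.
move=> actP finF finX meetX.
pose T := {classic U}; pose actT : G -> T -> T := act.
have actTP : is_left_action actT by [].
pose fin (f : T) := `[< finite_set (act_orbit actT f) >].
pose s := [seq f <- fset_set (F : set T) | fin f].
pose s' := [seq f <- fset_set (F : set T) | ~~ fin f].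
pose O := act_orbit (fun g => map (actT g)) s.
have fin_s f : f \in s -> finite_set (act_orbit actT f).
  by rewrite mem_filter => /andP[/asboolP].
have finO : finite_set O by exact: finite_act_orbit_map.
(* The entry of [t] at the position of [f]; for [f] in [s] and [t] in [O] the default of [nth] is
   never reached. *)
pose p (f : T) (t : seq T) : T := nth f t (index f s).
have pE f g : f \in s -> p f (map (actT g) s) = actT g f.
  by move=> fs; rewrite /p (nth_map f) ?index_mem ?nth_index.
have OX t : O t -> exists2 f, f \in s & X (p f t).
  move=> [g0 _ <-]; apply: contrapT => no_f.
  have /boolp.choice[h hP] t' : exists k, O t' -> t' = map (actT k) (map (actT g0) s).
    have [[k _ <-]|] := pselect (O t'); last by exists 1%g.
    exists (k * g0^-1)%g => _; rewrite -map_comp; apply: eq_map => u /=.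
    by rewrite actTP.2 actK.
  (* For [t' = g s], the element [(h t')^-1 * g] sends [s] to [g0 s], which has no entry in [X]. So
     if it sends a point [f] of [F] to [x] in [X], then [f] lies in [s'] and [g] sends [f] to
     [h t' x], as a pair of [L] prescribes. *)
  pose L := [seq (f, actT (h y.2) y.1) | f <- s',
              y <- [seq (x, t') | x <- fset_set (X : set T), t' <- fset_set O]].
  have [f||g gP] := @infinite_orbits_not_cover _ T actT s' L actTP.
  - by rewrite mem_filter => /andP[/asboolPn].
  - by move=> _ /allpairsP[[f y] [/= fs' _ ->]].
  pose t' := map (actT g) s; have Ot' : O t' by exists g.
  have [x [Xx [f Ff fx]]] := meetX ((h t')^-1 * g)%g.
  have {}Ff : (f : T) \in fset_set (F : set T) by rewrite in_fset_set// inE.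
  have [fin_f|ninf_f] := boolP (fin f).
    have fs : (f : T) \in s by rewrite mem_filter fin_f.
    apply: no_f; exists f => //; rewrite pE//.
    have := congr1 (map (actT (h t')^-1%g)) (hP t' Ot').
    rewrite (mapK (actK _ _ _ _ actTP)) -map_comp => /eq_in_map/(_ f fs) /= <-.
    by rewrite -actTP.2 [actT _ _]fx.
  apply: (gP (f, actT (h t') x)); last by rewrite /= -fx actP.2 /actT actKV.
  apply/allpairsP; exists (f, (x, t')); split=> //=; first by rewrite mem_filter ninf_f.
  by apply/allpairsP; exists (x, t'); rewrite !in_fset_set// !inE.
(* Count the pairs of [t] in [O] and [f] in [s] with [p f t] in [X]: by [OX] each [t] occurs at
   least once. *)
have cardO_le : ((set_card O)%:R : rat) <=
    \sum_(f <- s) (set_card (O `&` p f @^-1` X))%:R.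
  rewrite -natr_sum ler_nat.
  under eq_bigr do rewrite set_card_setI//.
  rewrite exchange_big /set_card card_fset_sum1 /=.
  rewrite big_seq [leqRHS]big_seq; apply: leq_sum => t.
  rewrite in_fset_set// inE => /OX[f fs Xf].
  rewrite (big_rem f)//= [X in (_ <= X + _)%N](_ : _ = 1%N) ?leq_addr//.
  by have -> : t \in (p f @^-1` X : set {classic (seq T)}) by rewrite inE.
have cardO_gt0 : 0 < ((set_card O)%:R : rat).
  rewrite ltr0n; apply: set_card_gt0 => //; exists s.
  exact: act_orbit_id (map_left_action _ _ _ actTP).
rewrite -(ler_pM2l cardO_gt0) mulr1 (le_trans cardO_le)//.
rewrite [X in _ * X](bigID fin) /= -[X in _ * (X + _)]big_filter mulrDr ler_wpDr//.
  rewrite mulr_ge0 ?ler0n// sumr_ge0// => f _.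
  by rewrite mulr_ge0 ?ler0n ?inv_card_ge0.
rewrite big_distrr /= big_seq [leRHS]big_seq ler_sum// => f fs.
have fin_f := fin_s f fs.
have card_f : ((set_card (act_orbit act f))%:R : rat) != 0.
  rewrite pnatr_eq0 -lt0n; apply: set_card_gt0 => //; exists f; exact: act_orbit_id.
have ps : p f s = f by rewrite /p nth_index.
have := set_card_orbit_preimage _ _ _ _ _ (p f) s X (map_left_action _ _ _ actTP) actTP.
rewrite ps => /(_ (fun g => pE f g fs) finO).
move=> /(congr1 (fun n => n%:R : rat)); rewrite !natrM -/O => E.
rewrite /inv_card (asboolT fin_f) mulrA -E mulfK//.
Qed.

Theorem theorem1p1 (G : groupType) (U : Type) (act : G -> U -> U)
    (act_action : is_left_action act)
    (FF : set (set U))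
    (FF_invariant : invariant_family act FF)
    (FF_finite : forall F, FF F -> finite_set F)
    (FF_bounded : exists m : nat, forall F, FF F -> (set_card F <= m)%N)
    (X : set U)
    (X_finite : finite_set X)
    (X_representatives : forall F, FF F -> (X `&` F) !=set0)
    (F : set U) (FF_F : FF F)
    (n : nat) (V : 'I_n -> set U)
    (V_injective : injective V)
    (V_orbits : range V = [set W | orbits act W /\ (F `&` W) !=set0]) :
  1 <= \sum_(i < n)
         (set_card (F `&` V i))%:R * (set_card (X `&` V i))%:R * inv_card (V i).
Proof.
have finF := FF_finite F FF_F.
have meetX g : (X `&` act g @` F) !=set0.
  exact: X_representatives (FF_invariant g F FF_F).
apply: le_trans (sum_orbit_density_ge1 _ _ _ F X act_action finF X_finite meetX) _.
(* Expand the size of [F] meet [V i] over the points of [F] and exchange the sums; for each [f] only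
   the term of its own orbit is kept, the others being nonnegative. *)
under [leRHS]eq_bigr do rewrite set_card_setI// natr_sum -mulrA big_distrl.
rewrite exchange_big /= big_seq [leRHS]big_seq ler_sum// => f.
rewrite in_fset_set// inE => Ff.
have [i _ Vi] : range V (act_orbit act f).
  rewrite V_orbits; split; first by exists f.
  by exists f; split=> //; exact: act_orbit_id.
rewrite (bigD1 i)//= Vi.
have -> : f \in (act_orbit act f : set {classic U}).
  by rewrite inE; exact: act_orbit_id.
rewrite mul1r [X `&` _]setIC lerDl sumr_ge0// => j _.
by rewrite !mulr_ge0 ?ler0n ?inv_card_ge0.
Qed.
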